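(* Let $q\in\{1,-1\}$ and $i\in\{1,\dots,5\}$. The Hom-Leibniz algebra $(\mathcal{W}^q,\{\cdot,\cdot\}^i,\alpha)$ induced by $P_0^i$ is multiplicative if and only if $i=1$ and $\nu_1=\nu_2=\nu_3=\nu_4=\gamma=0$.
   Context: $\mathbb{K}$ is a field of characteristic zero. For $n\in\mathbb{Z}$ put $[n]=n$ if $q=1$ and $[n]=(-1)^{n-1}n$ if $q=-1$. $\mathcal{W}^q$ is the $\mathbb{K}$-vector space with basis $\{L_n,W_n\mid n\in\mathbb{Z}\}$, with the skew-symmetric bilinear product determined by $[L_m,L_n]=[m-n]L_{m+n}$, $[L_m,W_n]=[m-n]W_{m+n}$, $[W_m,W_n]=0$, and with the linear map $\alpha(L_n)=(q^n+q^{-n})L_n$, $\alpha(W_n)=(q^n+q^{-n})W_n$. The degree-$0$ averaging operators are, for all $m\in\mathbb{Z}$, with $\delta=\delta_{m,0}$ ($1$ if $m=0$, $0$ otherwise): $P_0^1(L_m)=\nu_1\delta L_{m}+(\nu_3\delta+\gamma)W_{m}$, $P_0^1(W_m)=\nu_2\delta L_{m}+\nu_4\delta W_{m}$; $P_0^2(L_m)=(\nu_1\delta+\beta)L_{m}+(\nu_3\delta+\gamma)W_{m}$, $P_0^2(W_m)=\nu_2\delta L_{m}+\nu_4\delta W_{m}$; $P_0^3(L_m)=(\nu_1\delta+\beta)L_{m}+\nu_3\delta W_{m}$, $P_0^3(W_m)=\nu_2\delta L_{m}+(\nu_4\delta+\beta)W_{m}$; $P_0^4(L_m)=(\nu_1\delta+\gamma)L_{m}+\nu_3\delta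 W_{m}$, $P_0^4(W_m)=\nu_2\delta L_{m}+(\nu_4\delta+\beta)W_{m}$; $P_0^5(L_m)=(\nu_1\delta+\gamma)L_{m}+\big(\nu_3\delta+\frac{\gamma\theta-\gamma^2}{\beta}\big)W_{m}$, $P_0^5(W_m)=(\nu_2\delta+\beta)L_{m}+(\nu_4\delta+\theta-\gamma)W_{m}$; with $\nu_1,\dots,\nu_4,\gamma,\theta\in\mathbb{K}$, $\beta\in\mathbb{K}\setminus\{0\}$. The induced product is the bilinear product $\{x,y\}^i=[P_0^i(x),y]$ on $\mathcal{W}^q$. A Hom-algebra $(A,\{\cdot,\cdot\},\alpha)$ is multiplicative if $\alpha(\{x,y\})=\{\alpha(x),\alpha(y)\}$ for all $x,y\in A$. *)

(* Defs.v *)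
From HB Require Import structures.
From mathcomp Require Import all_boot all_order all_algebra.
From mathcomp.multinomials Require Import freeg.

Set Implicit Arguments.
Unset Strict Implicit.
Unset Printing Implicit Defensive.

Import GRing.Theory.
Local Open Scope ring_scope.

(* The vector space with basis {L_n, W_n | n in Z}: the index [inl n] stands
   for L_n and [inr n] for W_n. *)
Notation Wq K := {freeg (int + int)%type / K}.

Section WqAlgebra.
Variables (K : fieldType) (q : K).

Definition Lb (n : int) : Wq K := << inl n >>.
Definition Wb (n : int) : Wq K := << inr n >>.

(* Linear and bilinear extension of maps given on the basis. *)
Definition linext (f : int + int -> Wq K) : Wq K -> Wq K := fglift f.

Definition bilinext (f : int + int -> int + int -> Wq K) (x y : Wq K) : Wq K :=
  fglift (fun a => fglift (f a) y : Wq K) x.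

(* Only used for q = 1 and q = -1, so the second branch is the case q = -1. *)
Definition qint (n : int) : K :=
  if q == 1 then n%:~R else (-1) ^ (n - 1) * n%:~R.

(* The value of [W_m, L_n] is the one forced by skew-symmetry. *)
Definition bracket_basis (a b : int + int) : Wq K :=
  match a, b with
  | inl m, inl n => qint (m - n) *: Lb (m + n)
  | inl m, inr n => qint (m - n) *: Wb (m + n)
  | inr m, inl n => - (qint (n - m) *: Wb (n + m))
  | inr m, inr n => 0
  end.

Definition bracket : Wq K -> Wq K -> Wq K := bilinext bracket_basis.

Definition alpha : Wq K -> Wq K :=
  linext (fun a => match a with
    | inl n => (q ^ n + q ^ (- n)) *: Lb n
    | inr n => (q ^ n + q ^ (- n)) *: Wb n
    end).

Definition kron0 (m : int) : K := (m == 0)%:R.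

Section AveragingOperators.
Variables nu1 nu2 nu3 nu4 beta gamma theta : K.

Definition P0_1 : Wq K -> Wq K :=
  linext (fun a => match a with
    | inl m => (nu1 * kron0 m) *: Lb m + (nu3 * kron0 m + gamma) *: Wb m
    | inr m => (nu2 * kron0 m) *: Lb m + (nu4 * kron0 m) *: Wb m
    end).

Definition P0_2 : Wq K -> Wq K :=
  linext (fun a => match a with
    | inl m => (nu1 * kron0 m + beta) *: Lb m + (nu3 * kron0 m + gamma) *: Wb m
    | inr m => (nu2 * kron0 m) *: Lb m + (nu4 * kron0 m) *: Wb m
    end).

Definition P0_3 : Wq K -> Wq K :=
  linext (fun a => match a with
    | inl m => (nu1 * kron0 m + beta) *: Lb m + (nu3 * kron0 m) *: Wb m
    | inr m => (nu2 * kron0 m) *: Lb m + (nu4 * kron0 m + beta) *: Wb m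
    end).

Definition P0_4 : Wq K -> Wq K :=
  linext (fun a => match a with
    | inl m => (nu1 * kron0 m + gamma) *: Lb m + (nu3 * kron0 m) *: Wb m
    | inr m => (nu2 * kron0 m) *: Lb m + (nu4 * kron0 m + beta) *: Wb m
    end).

Definition P0_5 : Wq K -> Wq K :=
  linext (fun a => match a with
    | inl m => (nu1 * kron0 m + gamma) *: Lb m
               + (nu3 * kron0 m + (gamma * theta - gamma ^+ 2) / beta) *: Wb m
    | inr m => (nu2 * kron0 m + beta) *: Lb m
               + (nu4 * kron0 m + theta - gamma) *: Wb m
    end).

(* Only meaningful for 1 <= i <= 5; other values of i give the zero map. *)
Definition P0 (i : nat) : Wq K -> Wq K :=
  match i with
  | 1%N => P0_1
  | 2%N => P0_2
  | 3%N => P0_3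
  | 4%N => P0_4
  | 5%N => P0_5
  | _ => fun=> 0
  end.

End AveragingOperators.

Definition induced_product (P : Wq K -> Wq K) (x y : Wq K) : Wq K :=
  bracket (P x) y.

End WqAlgebra.

Definition hom_multiplicative (K : fieldType) (A : lmodType K)
    (mu : A -> A -> A) (al : A -> A) : Prop :=
  forall x y : A, al (mu x y) = mu (al x) (al y).

(* Main.v *)
Require Import Defs.
From HB Require Import structures.
From mathcomp Require Import all_boot all_order all_algebra.
From mathcomp.multinomials Require Import freeg.

(** Since q = 1 or q = -1, the twisting map acts on the degree-n part of W^q,
    spanned by L_n and W_n, as the scalar 2 q^n ([alpha_homog]). The operators
    P_0^i and the bracket respect degrees, so for x of degree m and y of degree
    n the two sides of the multiplicativity identity are 2 q^(m+n) {x, y} and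
    4 q^(m+n) {x, y}. In characteristic zero the identity therefore says exactly
    that the induced product {x, y} = [P x, y] vanishes.

    A homogeneous element u L_m + v W_m killed by the bracket with L_(m+1) is
    zero, because [-1] and [1] are nonzero ([bracket_homog_Lb_inj]). So the
    product vanishes only if P = 0 ([multiplicative_degree0]), and it remains to
    see when an operator of the list is zero. In degrees m <> 0, where the
    nu-terms disappear, P_0^2, ..., P_0^5 each have a coefficient beta <> 0,
    while P_0^1 is left with gamma; its degree-0 part then gives nu_1, ..., nu_4. *)

Set Implicit Arguments.
Unset Strict Implicit.
Unset Printing Implicit Defensive.

Import GRing.Theory.
Local Open Scope ring_scope.

HB.instance Definition _ (R : nzRingType) (I : choiceType) (M : lmodType R)
    (f : I -> M) :=
  GRing.isAdditive.Build {freeg I / R} M (fglift f) (lift_is_additive f).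

Lemma fglift_is_scalable (R : nzRingType) (I : choiceType) (M : lmodType R)
  (f : I -> M) : scalable (fglift f).
Proof.
move=> c; elim/freeg_ind_dom0 => [|k x D _ _ IH].
  by rewrite scaler0 raddf0 scaler0.
have scaleU : c *: << k *g x >> = << c * k *g x >> :> {freeg I / R}.
  by apply/eqP/freeg_eqP => y; rewrite coeffZ !coeffU mulrA.
by rewrite scalerDr !raddfD /= IH scaleU !liftU scalerA.
Qed.

HB.instance Definition _ (R : nzRingType) (I : choiceType) (M : lmodType R)
    (f : I -> M) :=
  GRing.isScalable.Build R {freeg I / R} M *:%R (fglift f)
    (fglift_is_scalable f).

Definition degree (a : int + int) : int :=
  match a with inl n => n | inr n => n end.

Definition homog (K : fieldType) (m : int) (u v : K) : Wq K :=
  u *: Lb K m + v *: Wb K m.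

Lemma linextU (K : fieldType) (f : int + int -> Wq K) a :
  linext f << a >> = f a.
Proof. by rewrite /linext liftU scale1r. Qed.

Lemma homog_eq0 (K : fieldType) m (u v : K) :
  homog m u v = 0 -> u = 0 /\ v = 0.
Proof.
move=> uv0; split.
  move/(congr1 (coeff (inl m))): uv0.
  by rewrite coeffD !coeffZ !coeffU coeff0 eqxx !mulr1 !mulr0 addr0.
move/(congr1 (coeff (inr m))): uv0.
by rewrite coeffD !coeffZ !coeffU coeff0 eqxx !mulr1 !mulr0 add0r.
Qed.

Lemma linextZ (K : fieldType) (f : int + int -> Wq K) c x :
  linext f (c *: x) = c *: linext f x.
Proof. exact: linearZ. Qed.

Lemma alphaZ (K : fieldType) (q c : K) x :
  alpha q (c *: x) = c *: alpha q x.
Proof. exact: linextZ. Qed.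

Lemma alphaD (K : fieldType) (q : K) x y :
  alpha q (x + y) = alpha q x + alpha q y.
Proof. exact: linearD. Qed.

Lemma bracketZl (K : fieldType) (q c : K) x y :
  bracket q (c *: x) y = c *: bracket q x y.
Proof. exact: linearZ. Qed.

Lemma bracketZr (K : fieldType) (q c : K) x y :
  bracket q x (c *: y) = c *: bracket q x y.
Proof.
rewrite /bracket /bilinext -[x]freeg_sumE !linear_sum /=.
by apply: eq_bigr => a _; rewrite !liftU linearZ /= scalerA mulrC -scalerA.
Qed.

Lemma bracket_homog_Lb (K : fieldType) (q : K) m n u v :
  bracket q (homog m u v) (Lb K n) =
  homog (m + n) (u * qint q (m - n)) (- (v * qint q (n - m))).
Proof.
rewrite /bracket /bilinext linearD !linearZ /= !liftU !scale1r /=.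
by rewrite /homog scalerN !scalerA scaleNr (addrC n m).
Qed.

Section SignParameter.
Variables (K : fieldType) (charK : [pchar K] =i pred0).
Variables (q : K) (hq : q = 1 \/ q = -1).

Lemma two_neq0 : 2%:R != 0 :> K.
Proof. by have /pcharf0P -> := charK. Qed.

Lemma q_neq0 : q != 0.
Proof. by case: hq => ->; rewrite ?oppr_eq0 oner_neq0. Qed.

Lemma qexpN n : q ^ (- n) = q ^ n.
Proof.
rewrite -exprz_inv; congr (_ ^ _).
by case: hq => ->; rewrite ?invrN invr1.
Qed.

Lemma qint1_neq0 : qint q 1 != 0.
Proof.
by rewrite /qint; case: ifP => _; rewrite ?subrr ?expr0z ?mul1r oner_neq0.
Qed.

Lemma qintN1_neq0 : qint q (- 1) != 0.
Proof.
rewrite /qint mulrNz; case: ifP => _; rewrite ?mulrN oppr_eq0 ?oner_neq0 //.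
by rewrite mulr1 expfz_neq0 // oppr_eq0 oner_neq0.
Qed.

Lemma alphaU a : alpha q << a >> = (2%:R * q ^ degree a) *: << a >>.
Proof.
by rewrite /alpha linextU; case: a => n; rewrite qexpN -mulr2n mulr_natl.
Qed.

Lemma alpha_homog m u v :
  alpha q (homog m u v) = (2%:R * q ^ m) *: homog m u v.
Proof.
rewrite /homog alphaD !alphaZ !alphaU /=.
by rewrite scalerDr !scalerA ![_ * (2%:R * _)]mulrC.
Qed.

(** Every element of degree m commutes with L_m, so the test vector is taken in
    the next degree, where the structure constants are [-1] and [1]. *)
Lemma bracket_homog_Lb_inj m u v :
  bracket q (homog m u v) (Lb K (m + 1)) = 0 -> u = 0 /\ v = 0.
Proof.
rewrite bracket_homog_Lb opprD addNKr (addrC m 1) addrK.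
case/homog_eq0 => /eqP + /eqP.
rewrite oppr_eq0 !mulf_eq0 (negPf qint1_neq0) (negPf qintN1_neq0) !orbF.
by move=> /eqP -> /eqP ->.
Qed.

(** Comparing 2 q^(m+n) {x, y} with 4 q^(m+n) {x, y} forces {x, y} = 0, and
    the choice y = L_(m+1) recovers P x from the vanishing of [P x, y]. *)
Lemma multiplicative_degree0 (f : int + int -> Wq K) (u v : int + int -> K) :
  (forall a, f a = homog (degree a) (u a) (v a)) ->
  hom_multiplicative (induced_product q (linext f)) (alpha q) <->
  (forall a, u a = 0 /\ v a = 0).
Proof.
move=> fE; split=> [mult a | uv0].
  have := mult << a >> (Lb K (degree a + 1)).
  set m := degree a; rewrite /induced_product !alphaU /=.
  rewrite linextZ linextU fE -/m bracketZl bracketZr.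
  rewrite {1}bracket_homog_Lb alpha_homog -bracket_homog_Lb scalerA.
  set z := bracket _ _ _ => twice.
  apply: (@bracket_homog_Lb_inj m); rewrite -/z; apply/eqP.
  move/eqP: twice; rewrite -subr_eq0 -scalerBl scaler_eq0 => /orP[|//].
  rewrite mulrACA -expfzDr ?q_neq0 // -mulrBl mulf_eq0.
  have -> : 2%:R - 2%:R * 2%:R = - 2%:R :> K.
    by rewrite {2}mulr2n mulrDl !mul1r opprD addrA subrr sub0r.
  by rewrite oppr_eq0 (negPf two_neq0) (negPf (expfz_neq0 _ q_neq0)).
have P0 x : linext f x = 0.
  rewrite /linext -[x]freeg_sumE linear_sum big1 //= => a _.
  have [ua va] := uv0 a.
  by rewrite liftU fE ua va /homog !scale0r addr0 scaler0.
move=> x y; rewrite /induced_product !P0.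
by rewrite /bracket /bilinext /alpha /linext !linear0.
Qed.

Corollary multiplicative_linext (lL lW wL wW : int -> K) :
  hom_multiplicative (induced_product q (linext (fun a => match a with
    | inl m => lL m *: Lb K m + lW m *: Wb K m
    | inr m => wL m *: Lb K m + wW m *: Wb K m
    end))) (alpha q) <->
  (forall m, (lL m = 0 /\ lW m = 0) /\ (wL m = 0 /\ wW m = 0)).
Proof.
pose u a := match a with inl m => lL m | inr m => wL m end.
pose v a := match a with inl m => lW m | inr m => wW m end.
apply: iff_trans (@multiplicative_degree0 _ u v _) _; first by case.
split=> [uv0 m | uv0 [] m]; last 2 first.
- by case: (uv0 m).
- by case: (uv0 m).
by split; [exact: (uv0 (inl m)) | exact: (uv0 (inr m))].
Qed.

End SignParameter.

Theorem proposition4p15 (K : fieldType) (charK : [pchar K] =i pred0)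
    (q : K) (hq : q = 1 \/ q = -1)
    (i : nat) (hi : (1 <= i <= 5)%N)
    (nu1 nu2 nu3 nu4 beta gamma theta : K) (hbeta : beta != 0) :
  hom_multiplicative
    (induced_product q (P0 nu1 nu2 nu3 nu4 beta gamma theta i)) (alpha q)
  <-> (i = 1%N /\ nu1 = 0 /\ nu2 = 0 /\ nu3 = 0 /\ nu4 = 0 /\ gamma = 0).
Proof.
(* The nu-terms live in degree 0 only; degree 1 isolates the others. *)
have mulk0 (c : K) : c * kron0 K 0 = c by rewrite /kron0 mulr1.
have mulk1 (c : K) : c * kron0 K 1 = 0 by rewrite /kron0 mulr0.
have beta0 : beta <> 0 by apply/eqP.
have crit := multiplicative_linext charK hq.
case: i hi => [|[|[|[|[|[|i]]]]]] // _; rewrite /P0.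
- apply: iff_trans (crit _ _ _ _) _.
  split=> [P0 | [_ [-> [-> [-> [-> ->]]]]] m]; last by rewrite !mul0r addr0.
  have [[_ +] _] := P0 1; rewrite mulk1 add0r => gamma0.
  by have [[+ +] [+ +]] := P0 0; rewrite !mulk0 gamma0 addr0.
- split=> [/crit/(_ 1)[[+ _] _] | [//]].
  by rewrite mulk1 add0r.
- split=> [/crit/(_ 1)[[+ _] _] | [//]].
  by rewrite mulk1 add0r.
- split=> [/crit/(_ 1)[_ [_ +]] | [//]].
  by rewrite mulk1 add0r.
- split=> [/crit/(_ 1)[_ [+ _]] | [//]].
  by rewrite mulk1 add0r.
Qed.
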